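(* Let $N$ be a positive integer, let $t_{\min}\le t_{\max}$ be real numbers, and let $C_N:[t_{\min},t_{\max}]\to\mathbb{R}^N$ be given by $C_N(t)=(t,t^2,\dots,t^N)$. Let $v$ be a point in the convex hull of the image of $C_N$, and consider any two representations of $v$, each of which is a convex combination of at most $\frac{N+1}{2}$ points on this curve if $N$ is odd, or a convex combination of at most $\frac{N+2}{2}$ points on this curve, one of which is the point $C_N(t_{\min})$, if $N$ is even. Then it is possible to obtain one representation from the other by a finite sequence of steps of the following three kinds: (1) exchanging two terms with each other; (2) adding or removing a term with coefficient zero; (3) combining two terms using the same point on the curve into a single term, or splitting one term into two terms using the same point on the curve.
   Context: A representation of $v$ as a convex combination of points on the curve is a finite list of terms $(c_j,t_j)$, $j=1,\dots,M$, with $c_j\ge0$, $\sum_j c_j=1$, $t_j\in[t_{\min},t_{\max}]$ and $\sum_j c_jC_N(t_j)=v$. Zero coefficients are allowed (also on the term $C_N(t_{\min})$ when $N$ is even). Combining two terms $(c,t)$ and $(c',t)$ gives the term $(c+c',t)$; splitting is the inverse operation (with both new coefficients nonnegative). All intermediate lists are again representations of $v$ as convex combinations of finitely many points on the curve. *)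

(* Defs.v *)
From mathcomp Require Import all_boot all_order all_algebra.
From mathcomp Require Import boolp classical_sets set_interval reals convex.
From Stdlib Require Export Relation_Operators.

Set Implicit Arguments.
Unset Strict Implicit.
Unset Printing Implicit Defensive.

Import Order.TTheory GRing.Theory Num.Theory.

Local Open Scope classical_set_scope.
Local Open Scope ring_scope.

Definition moment_curve (R : realType) (N : nat) (t : R) : 'rV[R]_N :=
  \row_(i < N) t ^+ i.+1.

Definition convex_hull (R : realType) (E : lmodType R) (A : set E) : set E :=
  smallest (@convex_set R E) A.

(* The term (c, t) has coefficient c and stands for the point
   moment_curve N t. *)
Definition term (R : realType) : Type := (R * R)%type.

Definition is_representation (R : realType) (N : nat) (tmin tmax : R)
    (v : 'rV[R]_N) (s : seq (term R)) : Prop :=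
  [/\ forall x, x \in s -> 0 <= x.1,
      \sum_(x <- s) x.1 = 1,
      forall x, x \in s -> tmin <= x.2 <= tmax
    & \sum_(x <- s) x.1 *: moment_curve N x.2 = v].

(* The number of points is the number of terms, so it counts repeated points
   and terms with coefficient zero. *)
Definition few_points (R : realType) (N : nat) (tmin : R) (s : seq (term R)) :
    bool :=
  if odd N then (size s <= N.+1./2)%N
  else (size s <= N.+2./2)%N &&
       (moment_curve N tmin \in [seq moment_curve N x.2 | x <- s]).

Inductive move (R : realType) : seq (term R) -> seq (term R) -> Prop :=
| move_exchange s1 s2 s3 x y :
    move (s1 ++ x :: s2 ++ y :: s3) (s1 ++ y :: s2 ++ x :: s3)
| move_add0 s1 s2 t :
    move (s1 ++ s2) (s1 ++ (0, t) :: s2)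
| move_remove0 s1 s2 t :
    move (s1 ++ (0, t) :: s2) (s1 ++ s2)
| move_combine s1 s2 s3 c c' t :
    move (s1 ++ (c, t) :: s2 ++ (c', t) :: s3) (s1 ++ (c + c', t) :: s2 ++ s3)
| move_split s1 s2 s3 c c' t :
    move (s1 ++ (c + c', t) :: s2 ++ s3) (s1 ++ (c, t) :: s2 ++ (c', t) :: s3).

(* Requiring both lists to be representations of v makes an added zero term
   have its parameter in [tmin, tmax] and the two coefficients of a split
   nonnegative. *)
Definition step (R : realType) (N : nat) (tmin tmax : R) (v : 'rV[R]_N)
    (s s' : seq (term R)) : Prop :=
  [/\ is_representation tmin tmax v s, is_representation tmin tmax v s'
    & move s s'].

(* Main.v *)
(** Evaluating both representations on the polynomial that vanishes at every
    parameter in use except [t] shows that they give [t] the same total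
    coefficient, as soon as the number of distinct parameters is at most
    [N + 1]; for even [N] this bound holds because [tmin] is shared. A
    representation is moreover connected to the list of its total
    coefficients on any finite set of parameters containing its own. *)
Require Import Defs.
From mathcomp Require Import all_boot all_order all_algebra.
From mathcomp Require Import boolp classical_sets set_interval reals convex.

Set Implicit Arguments.
Unset Strict Implicit.
Unset Printing Implicit Defensive.

Import Order.TTheory GRing.Theory Num.Theory.

Local Open Scope classical_set_scope.
Local Open Scope ring_scope.

Definition mass (R : realType) (s : seq (term R)) (t : R) : R :=
  \sum_(x <- s | x.2 == t) x.1.

(** With [m := mass s] this is a normal form: once [T] is fixed, it depends on [s] only through its
    masses. *)
Definition terms_on (R : realType) (m : R -> R) (T : seq R) : seq (term R) :=
  [seq (m t, t) | t <- T].

Lemma moment_curve_inj (R : realType) (N : nat) :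
  (0 < N)%N -> injective (@moment_curve R N).
Proof.
by move=> N0 t u /rowP/(_ (Ordinal N0)); rewrite !mxE /= !expr1.
Qed.

Section Connectivity.

Variables (R : realType) (N : nat) (tmin tmax : R) (v : 'rV[R]_N).
Implicit Types s : seq (term R).

Local Notation rep := (is_representation tmin tmax v).
Local Notation connected := (clos_refl_trans _ (step tmin tmax v)).

(** A general [g] covers both invariants of a move: a constant [g] gives the sum of the
    coefficients, the curve gives the represented point. *)
Lemma move_sum (V : lmodType R) (g : R -> V) s s' :
  move s s' -> \sum_(x <- s) x.1 *: g x.2 = \sum_(x <- s') x.1 *: g x.2.
Proof.
case=> [s1 s2 s3 x y|s1 s2 t|s1 s2 t|s1 s2 s3 c c' t|s1 s2 s3 c c' t];
  rewrite ?(big_cat, big_cons) /= ?scale0r ?add0r //.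
- by congr (_ + _); rewrite addrCA [RHS]addrCA; congr (_ + _); rewrite addrCA.
- by rewrite scalerDl -addrA [X in _ + (_ + X)]addrCA.
- by rewrite scalerDl -addrA [X in _ = _ + (_ + X)]addrCA.
Qed.

Lemma move_step s s' :
  move s s' -> rep s ->
  (forall x, x \in s' -> 0 <= x.1 /\ tmin <= x.2 <= tmax) ->
  step tmin tmax v s s'.
Proof.
move=> mv reps s'P; split=> //; case: (reps) => _ s1 _ sv; split.
- by move=> x /s'P[].
- have sum1 s0 : \sum_(x <- s0) x.1 *: (1 : R^o) = \sum_(x <- s0) x.1.
    by apply: eq_bigr => x _; exact: mulr1.
  by rewrite -s1 -!sum1 (move_sum (fun=> 1 : R^o) mv).
- by move=> x /s'P[].
- by rewrite -(move_sum (moment_curve N) mv).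
Qed.

Lemma move_sym s s' : move s s' -> move s' s.
Proof. by case=> *; constructor. Qed.

Lemma connected_sym s s' : connected s s' -> connected s' s.
Proof.
elim=> [{}s {}s' [reps reps' /move_sym mv]|{}s|a b c _ ba _ cb].
- exact: rt_step.
- exact: rt_refl.
- exact: rt_trans cb ba.
Qed.

(** The added zero terms are empty slots, one for each entry of [T], into which the terms of [s] can
    be combined. *)
Lemma connected_add0 (T : seq R) s :
  {in T, forall t, tmin <= t <= tmax} -> rep s ->
  connected s (terms_on (fun=> 0) T ++ s) /\ rep (terms_on (fun=> 0) T ++ s).
Proof.
move=> + reps; elim: T => [|t T IH] Tle; first by split=> //; exact: rt_refl.
have [|conn repT] := IH; first by move=> u uT; apply: Tle; rewrite inE uT orbT.
have st : step tmin tmax v (terms_on (fun=> 0) T ++ s)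
    (terms_on (fun=> 0) (t :: T) ++ s).
  apply: move_step => //; first exact: (move_add0 [::]).
  move=> x; rewrite inE => /predU1P[->|xs] /=.
    by split=> //; apply: Tle; rewrite mem_head.
  by case: repT => ge0 _ le _; split; [exact: ge0|exact: le].
split; last by case: st.
by apply: rt_trans conn _; exact: rt_step.
Qed.

(** Each term of [s] in turn is combined into the slot of its parameter; [m] varies in the induction
    to record the slots filled so far. *)
Lemma connected_absorb (T : seq R) s (m : R -> R) :
  uniq T -> {in s, forall x, x.2 \in T} -> rep (terms_on m T ++ s) ->
  connected (terms_on m T ++ s) (terms_on (fun t => m t + mass s t) T).
Proof.
move=> uT; elim: s m => [|[c t] s IH] m sT repm.
  rewrite cats0; have -> : terms_on (fun t => m t + mass [::] t) T = terms_on m T.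
    by apply: eq_map => t; rewrite /mass big_nil addr0.
  exact: rt_refl.
pose m' u := m u + (if t == u then c else 0).
have st : step tmin tmax v (terms_on m T ++ (c, t) :: s) (terms_on m' T ++ s).
  have tT : t \in T by apply: (sT (c, t)); rewrite mem_head.
  have [ge0 _ le _] := repm.
  apply: move_step => //.
    case/splitPr: tT uT => T1 T2.
    rewrite cat_uniq /= negb_or => /and3P[_ /andP[tT1 _] /andP[tT2 _]].
    (* As [T] has no repetition, [t] lies in neither [T1] nor [T2], so only the slot of [t]
       changes. *)
    have m'E T' : t \notin T' -> terms_on m' T' = terms_on m T'.
      move=> tT'; apply/eq_in_map => u uT'; rewrite /m'.
      by case: eqP => [tu|_]; [rewrite tu uT' in tT'|rewrite addr0].
    rewrite /terms_on !map_cat /= -!catA /= -!/(terms_on _ _) !m'E //.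
    by rewrite /m' eqxx; exact: move_combine.
  have c0 : 0 <= c by apply: (ge0 (c, t)); rewrite mem_cat mem_head orbT.
  move=> x; rewrite mem_cat => /orP[/mapP[u uT' ->]|xs] /=.
    have muL : (m u, u) \in terms_on m T ++ (c, t) :: s.
      by rewrite mem_cat; apply/orP; left; apply/mapP; exists u.
    split; last exact: (le _ muL).
    by apply: addr_ge0; [exact: (ge0 _ muL)|case: ifP].
  by split; [apply: ge0|apply: le]; rewrite mem_cat inE xs !orbT.
apply: rt_trans (rt_step _ _ _ _ st) _.
have -> : terms_on (fun u => m u + mass ((c, t) :: s) u) T =
          terms_on (fun u => m' u + mass s u) T.
  apply: eq_map => u; rewrite /m' /mass big_cons /=.
  by case: eqP; rewrite ?addr0 ?addrA.
apply: IH; last by case: st.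
by move=> x xs; apply: sT; rewrite inE xs orbT.
Qed.

Lemma connected_mass (T : seq R) s :
  uniq T -> {in T, forall t, tmin <= t <= tmax} ->
  {in s, forall x, x.2 \in T} -> rep s -> connected s (terms_on (mass s) T).
Proof.
move=> uT Tle sT reps; have [conn rep0] := connected_add0 Tle reps.
apply: rt_trans conn _.
have -> : terms_on (mass s) T = terms_on (fun t => 0 + mass s t) T.
  by apply: eq_map => t; rewrite add0r.
exact: connected_absorb.
Qed.

(** The moments of orders 0 to [N] are fixed by [v]: order 0 is the total coefficient 1, and the
    others are the coordinates of [v]. Sums against polynomials of degree at most [N] are
    combinations of these. *)
Lemma rep_horner s s' (p : {poly R}) :
  rep s -> rep s' -> (size p <= N.+1)%N ->
  \sum_(x <- s) x.1 * p.[x.2] = \sum_(x <- s') x.1 * p.[x.2].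
Proof.
(* For [0 < i <= N] the sum has one term, coordinate [i - 1] of [v]; this form avoids building an
   ordinal. *)
pose val (i : nat) := if i is 0 then 1 else \sum_(j < N | j.+1 == i) v 0 j.
have moment s0 (i : 'I_N.+1) : rep s0 ->
    \sum_(x <- s0) x.1 * x.2 ^+ i = val i.
  case=> _ s1 _ sv; case: i => [[|i] /=] iN.
    by rewrite -s1; under eq_bigr do rewrite expr0 mulr1.
  rewrite (big_pred1 (Ordinal (iN : (i < N)%N))) // -sv summxE.
  by apply: eq_bigr => x _; rewrite !mxE.
have hornerE s0 : rep s0 -> (size p <= N.+1)%N ->
    \sum_(x <- s0) x.1 * p.[x.2] = \sum_(i < N.+1) p`_i * val i.
  move=> reps0 sp; under eq_bigr do rewrite (horner_coef_wide _ sp) mulr_sumr.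
  rewrite exchange_big /=; apply: eq_bigr => i _.
  rewrite -(moment s0) // mulr_sumr.
  by apply: eq_bigr => x _; rewrite mulrCA.
by move=> reps reps' sp; rewrite !hornerE.
Qed.

Lemma mass_eq (T : seq R) s s' (t : R) :
  rep s -> rep s' -> uniq T -> (size T <= N.+1)%N ->
  {in s, forall x, x.2 \in T} -> {in s', forall x, x.2 \in T} ->
  t \in T -> mass s t = mass s' t.
Proof.
move=> reps reps' uT sT ssT ss'T tT.
pose p := \prod_(u <- rem t T) ('X - u%:P).
have sp : (size p <= N.+1)%N.
  by rewrite size_prod_XsubC size_rem // prednK //; case: (T) tT.
have rootp u : root p u = (u != t) && (u \in T).
  by rewrite root_prod_XsubC mem_rem_uniq.
have sumE s0 : {in s0, forall x, x.2 \in T} ->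
    \sum_(x <- s0) x.1 * p.[x.2] = mass s0 t * p.[t].
  move=> s0T; rewrite /mass mulr_suml [RHS]big_mkcond /= !big_seq.
  apply: eq_bigr => x xs; case: eqP => [->//|/eqP xt].
  have /rootP -> : root p x.2 by rewrite rootp xt s0T.
  by rewrite mulr0.
have := rep_horner reps reps' sp; rewrite !sumE //.
(* The factor [p.[t]] cancels, since [t] is not among the roots of [p]. *)
by apply: mulIf; have := rootp t; rewrite eqxx /root /= => ->.
Qed.

End Connectivity.

(** For odd [N] the two lengths add up to at most [N + 1]. For even [N] they add up to at most
    [N + 2], but [tmin] occurs in both lists and is counted once. *)
Lemma few_points_size (R : realType) (N : nat) (tmin : R)
    (s s' : seq (term R)) :
  (0 < N)%N -> few_points N tmin s -> few_points N tmin s' ->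
  (size (undup (map snd s ++ map snd s')) <= N.+1)%N.
Proof.
move=> N0; rewrite /few_points; case: ifP => oN.
  move=> ss ss'; apply: leq_trans (size_undup _) _.
  rewrite size_cat !size_map; apply: leq_trans (leq_add ss ss') _.
  by rewrite addnn even_halfK //= oN.
(* Injectivity of the curve turns the shared point into a shared parameter. *)
move=> /andP[ss /mapP[x xs /(moment_curve_inj N0) tx]].
move=> /andP[ss' /mapP[y ys /(moment_curve_inj N0) ty]].
have ts : tmin \in map snd s by rewrite tx map_f.
have ts' : tmin \in map snd s' by rewrite ty map_f.
apply: (@leq_trans (size (map snd s ++ rem tmin (map snd s')))).
  apply: uniq_leq_size (undup_uniq _) _ => u.
  rewrite mem_undup !mem_cat => /orP[->//|us'].
  have [->|ut] := eqVneq u tmin; first by rewrite ts.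
  have := perm_mem (perm_to_rem ts') u; rewrite us' inE (negPf ut) /= => <-.
  by rewrite orbT.
rewrite size_cat size_rem // !size_map.
have s'0 : (0 < size s')%N by case: (s') ys.
rewrite -ltnS -addnS prednK //; apply: leq_trans (leq_add ss ss') _.
by rewrite addnn even_halfK //= oN.
Qed.

Theorem lemma23 (R : realType) (N : nat) (tmin tmax : R)
  (v : 'rV[R]_N) (s s' : seq (term R)) :
  (0 < N)%N -> tmin <= tmax ->
  convex_hull [set moment_curve N t | t in `[tmin, tmax]] v ->
  is_representation tmin tmax v s -> few_points N tmin s ->
  is_representation tmin tmax v s' -> few_points N tmin s' ->
  clos_refl_trans _ (step tmin tmax v) s s'.
Proof.
move=> N0 _ _ reps fs reps' fs'.
pose T := undup (map snd s ++ map snd s').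
have uT : uniq T by exact: undup_uniq.
have sT : {in s, forall x, x.2 \in T}.
  by move=> x xs; rewrite mem_undup mem_cat map_f.
have s'T : {in s', forall x, x.2 \in T}.
  by move=> x xs; rewrite mem_undup mem_cat (map_f snd xs) orbT.
have Tle : {in T, forall t, tmin <= t <= tmax}.
  have [[_ _ le _] [_ _ le' _]] := (reps, reps').
  move=> t; rewrite mem_undup mem_cat.
  by case/orP=> /mapP[x xs ->]; [exact: le|exact: le'].
(* Both lists reach the same normal form on [T]; the second chain is then reversed. *)
apply: rt_trans (connected_mass uT Tle sT reps) _.
have -> : terms_on (mass s) T = terms_on (mass s') T.
  apply/eq_in_map => t tT; congr (_, _).
  exact: (mass_eq reps reps' uT (few_points_size N0 fs fs')).
exact/connected_sym/connected_mass.
Qed.
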